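(* Let $l<m$ be integers, $h\in\mathbb{C}\setminus\{0\}$, $a_l,\dots,a_m\in\mathbb{C}$ with $a_la_m\neq0$, and let $$T(p)(x)=\sum_{k=l}^m a_k\,p(x-kh).$$ Then $T$ preserves the set of hyperbolic polynomials if and only if the following conditions hold: 1) $\mathrm{Re}\,h=0$; 2) $l=-m$; 3) all roots in $\mathbb{C}\setminus\{0\}$ of the generating function $Q(t)=\sum_{k=l}^m a_kt^k$ belong to the unit circle $\{z\in\mathbb{C}:|z|=1\}$; 4) $a_m\cdot a_{-m}>0$ (that is, this product is a positive real number).
   Context: A hyperbolic polynomial is a polynomial with real coefficients all of whose roots are real (nonzero real constants included). The zero polynomial is admitted as an image: ''$T$ preserves the set of hyperbolic polynomials'' means that for every hyperbolic $p$, $T(p)$ is hyperbolic or identically zero. *)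

(* Defs.v *)
From mathcomp Require Import all_boot all_order all_algebra.
From mathcomp Require Import reals.
From mathcomp Require Import complex.

Set Implicit Arguments.
Unset Strict Implicit.
Unset Printing Implicit Defensive.

Import Order.TTheory GRing.Theory Num.Theory.

Local Open Scope ring_scope.

(* [:: l; l + 1; ...; m], empty when m < l *)
Definition zrange (l m : int) : seq int :=
  [seq l + i%:Z | i <- iota 0 (absz (Num.max 0 (m - l + 1)))].

Lemma mem_zrange (l m k : int) : (k \in zrange l m) = (l <= k <= m).
Proof.
apply/mapP/andP => [[j] | [lk km]].
  rewrite mem_iota add0n /= => ltj ->; split; first by rewrite lerDl.
  have : (j%:Z < (absz (Num.max 0 (m - l + 1)))%:Z) by [].
  rewrite gez0_abs ?le_max ?lexx // lt_max => /orP[|] //.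
  by rewrite ltzD1 lerBrDl.
exists `|k - l|%N; last by rewrite gez0_abs ?subr_ge0 // subrKC.
rewrite mem_iota add0n /=.
rewrite -ltz_nat !gez0_abs ?subr_ge0 ?le_max ?lexx //.
by rewrite lt_max ltzD1 lerD2r km orbT.
Qed.

Section Defs.
Variable R : realType.
Implicit Types (p : {poly R[i]}) (a : int -> R[i]) (l m : int) (h t : R[i]).

(* Nonzero real constants are included, the zero polynomial is not. *)
Definition hyperbolic p : Prop :=
  [/\ p != 0, p \is a polyOver Num.real &
      forall z : R[i], root p z -> z \is Num.real].

Definition preserves_hyperbolic (T : {poly R[i]} -> {poly R[i]}) : Prop :=
  forall p, hyperbolic p -> hyperbolic (T p) \/ T p = 0.

(* Only the values a k with l <= k <= m are used. *)
Definition difference_op a l m h p : {poly R[i]} :=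
  \sum_(k <- zrange l m) a k *: (p \Po ('X - (k%:~R * h)%:P)).

Lemma difference_opE a l m h p (x : R[i]) :
  (difference_op a l m h p).[x] =
  \sum_(k <- zrange l m) a k * p.[x - k%:~R * h].
Proof.
rewrite horner_sum; apply: eq_bigr => k _.
by rewrite hornerZ horner_comp !hornerE.
Qed.

(* A Laurent polynomial in t, since l may be negative: the exponent is an
   integer, and the value is meaningful for t != 0 only. *)
Definition generating_function a l m t : R[i] :=
  \sum_(k <- zrange l m) a k * t ^ k.

End Defs.

(* Main.v *)
(* Write Q for the generating function and E for the complex exponential.

   Necessity. Applying T to x^n and reversing, the polynomial
   sum_k a_k (1 + k h c)^n in c is a product of real affine factors, so for
   fixed Re c its modulus is nondecreasing in |Im c|. With c = z / n and n -> oo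
   this passes to Q(E(h z)). If Q(E(h z)) = 0 with z not real, then Q(E(h w)) = 0
   on a whole vertical segment below z, which gives infinitely many roots of Q.
   So the zeros of Q(E(h z)) are real; since 2 pi i / h is a period, h is
   imaginary, and then |E(h z)| = 1 at real z. The values T(x^n)(0) are real, so
   sum_k a_k f(-k h) = sum_k conj(a_k) f(k h) for every polynomial f, and
   interpolation gives a_k = conj(a_(-k)).

   Sufficiency. If the roots of Q are the s_j^2 with |s_j| = 1, then T is a real
   multiple of the composition of the operators
   p |-> i (s_j^-1 p(x - h/2) - s_j p(x + h/2)). Each of them preserves
   hyperbolicity: off the real axis |p(x - h/2)| and |p(x + h/2)| differ,
   as can be seen factor by factor. *)
Require Import Defs.
From mathcomp Require Import all_boot all_order all_algebra.
From mathcomp Require Import reals.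
From mathcomp Require Import complex.
From mathcomp Require Import ring lra zify.
From mathcomp Require Import topology normedtype sequences derive exp trigo.

Set Implicit Arguments.
Unset Strict Implicit.
Unset Printing Implicit Defensive.

Import Order.TTheory GRing.Theory Num.Theory.
Import numFieldNormedType.Exports.

Local Open Scope ring_scope.

Local Notation "x %:C" := (real_complex _ x) (format "x %:C").

(** * The complex exponential and its limit formula *)

Section Exponential.
Variable R : realType.
Implicit Types (w z t : R[i]) (x y u v e : R) (n : nat).

Definition cexp w : R[i] :=
  Complex (expR (complex.Re w) * cos (complex.Im w)) (expR (complex.Re w) * sin (complex.Im w)).

Lemma cexp0 : cexp 0 = 1.
Proof. by rewrite /cexp /= expR0 cos0 sin0 mulr1 mulr0. Qed.

Lemma cexpD w z : cexp (w + z) = cexp w * cexp z.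
Proof.
case: w z => [a b] [c d]; rewrite /cexp /= expRD cosD sinD.
by apply/eqP; rewrite eq_complex /=; apply/andP; split; apply/eqP; ring.
Qed.

Lemma norm_cexp w : `|cexp w| = (expR (complex.Re w))%:C.
Proof.
rewrite normc_def /= !exprMn -mulrDr cos2Dsin2 mulr1 sqrtr_sqr ger0_norm //.
exact: expR_ge0.
Qed.

Lemma cexp_neq0 w : cexp w != 0.
Proof.
by rewrite -normr_eq0 norm_cexp (inj_eq (@complexI _) _ 0) gt_eqF ?expR_gt0.
Qed.

Lemma cexpN w : cexp (- w) = (cexp w)^-1.
Proof.
apply: (mulfI (cexp_neq0 w)); rewrite -cexpD subrr cexp0 divff //.
exact: cexp_neq0.
Qed.

Lemma cexpMn w n : cexp (n%:R * w) = cexp w ^+ n.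
Proof.
elim: n => [|n IH]; first by rewrite mul0r cexp0.
by rewrite -natr1 mulrDl mul1r cexpD IH exprSr.
Qed.

Lemma cexpMz w (k : int) : cexp (k%:~R * w) = cexp w ^ k.
Proof.
case: k => n; first by rewrite -pmulrn cexpMn.
by rewrite NegzE mulrNz mulNr cexpN -pmulrn cexpMn exprnN.
Qed.

Lemma cexp_period w : cexp (w + Complex 0 (pi *+ 2)) = cexp w.
Proof. by rewrite cexpD /cexp /= cos2pi sin2pi expR0 mul1r mulr0 mulr1. Qed.

(** Polar form: the real part of [w] is the logarithm of the modulus [r], the imaginary part is the
    angle [acos (x / r)], negated in the lower half plane because [acos] takes values in [0, pi]. *)
Lemma cexp_surj t : t != 0 -> exists w, cexp w = t.
Proof.
case: t => x y; rewrite eq_complex /= => xy0.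
have s0 : 0 < x ^+ 2 + y ^+ 2.
  rewrite lt_neqAle addr_ge0 ?sqr_ge0 // andbT eq_sym paddr_eq0 ?sqr_ge0 //.
  by rewrite !sqrf_eq0.
pose r := Num.sqrt (x ^+ 2 + y ^+ 2).
have r0 : 0 < r by rewrite sqrtr_gt0.
have r2 : r ^+ 2 = x ^+ 2 + y ^+ 2 by rewrite sqr_sqrtr // ltW.
have [s es] := expR_total r0.
have xr : `|x / r| <= 1.
  rewrite normrM normfV (gtr0_norm r0) ler_pdivrMr // mul1r.
  rewrite -(ler_pXn2r (n := 2)) ?nnegrE ?normr_ge0 ?(ltW r0) // real_normK ?num_real //.
  by rewrite r2 lerDl sqr_ge0.
have xr' : -1 <= x / r <= 1 by rewrite -ler_norml.
have sq : Num.sqrt (1 - (x / r) ^+ 2) = `|y| / r.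
  have -> : 1 - (x / r) ^+ 2 = (`|y| / r) ^+ 2.
    rewrite !expr_div_n real_normK ?num_real // r2; field.
    by rewrite gt_eqF.
  by rewrite sqrtr_sqr ger0_norm // divr_ge0 ?normr_ge0 // ltW.
have rn0 : r != 0 by rewrite gt_eqF.
have [y0|y0] := leP 0 y.
  exists (Complex s (acos (x / r))); rewrite /cexp /= es acosK ?in_itv //= sin_acos // sq.
  by rewrite ger0_norm //; congr Complex; field.
exists (Complex s (- acos (x / r))).
rewrite /cexp /= es cosN sinN acosK ?in_itv //= sin_acos // sq.
by rewrite ltr0_norm //; congr Complex; field.
Qed.

(** The difference quotient at 0 along the steps 1/(n+1), in epsilon form so that real and imaginary
    parts can be recombined by hand. *)
Lemma derive0_seq (g : R -> R) (d : R) : is_derive (0 : R) (1 : R) g d ->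
  forall e, 0 < e -> exists N, forall n, (N <= n)%N ->
    `|n.+1%:R * (g n.+1%:R^-1 - g 0) - d| <= e.
Proof.
move=> [dg gd] e e0; move: dg; rewrite /derivable => /cvg_ex [l cl].
have le : l = d by rewrite -gd; apply/esym/cvg_lim.
rewrite {}le in cl; move/cvgrPdist_le: cl => /(_ e e0).
rewrite near_withinE => /nbhs_ballP [r /= r0 H].
exists (Num.truncn r^-1) => n Nn.
have n0 : 0 < n.+1%:R :> R by rewrite ltr0n.
have := H n.+1%:R^-1; rewrite distrC invrK addr0 [_%:R^-1 *: _]mulr1; apply.
  rewrite /ball /= sub0r normrN ger0_norm ?invr_ge0 ?ler0n //.
  rewrite invf_plt ?posrE //.
  have := truncnS_gt r^-1 => /lt_le_trans; apply.
  by rewrite ler_nat.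
by rewrite invr_eq0 gt_eqF.
Qed.

Lemma cexp_derive0_seq w e : 0 < e -> exists N, forall n, (N <= n)%N ->
  `|n.+1%:R * (cexp (w / n.+1%:R) - 1) - w| <= e%:C.
Proof.
move=> e0; case: w => u v.
have du : is_derive (0 : R) (1 : R) (fun t : R => expR (t * u) * cos (t * v)) u.
  apply: is_derive_eq.
  by rewrite /GRing.scale /= !mul0r cos0 sin0 expR0; ring.
have dv : is_derive (0 : R) (1 : R) (fun t : R => expR (t * u) * sin (t * v)) v.
  apply: is_derive_eq.
  by rewrite /GRing.scale /= !mul0r cos0 sin0 expR0; ring.
have e2 : 0 < e / 2 by rewrite divr_gt0.
have [N1 H1] := derive0_seq du e2.
have [N2 H2] := derive0_seq dv e2.
exists (maxn N1 N2) => n; rewrite geq_max => /andP[/H1 A /H2 B].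
set z := _ - _.
have zE : z = (complex.Re z)%:C + 'i%C * (complex.Im z)%:C by exact: complexE.
have nE : n.+1%:R = (n.+1%:R : R)%:C :> R[i] by rewrite rmorph_nat.
have wE : Complex u v / n.+1%:R = Complex (n.+1%:R^-1 * u) (n.+1%:R^-1 * v).
  rewrite nE -(fmorphV (real_complex R)).
  by apply/eqP; rewrite eq_complex /=; apply/andP; split; apply/eqP; ring.
rewrite zE; apply: le_trans (ler_normD _ _) _.
rewrite normrM !normc_def /= !expr0n expr1n /= add0r sqrtr1 mul1r !addr0 !sqrtr_sqr.
rewrite -rmorphD lecR [e]splitr; apply: lerD.
  apply: le_trans A; rewrite /z wE nE /=; rewrite !mul0r cos0 expR0.
  by rewrite le_eqVlt; apply/orP; left; apply/eqP; congr (`| _ |); ring.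
apply: le_trans B; rewrite /z wE nE /=; rewrite !mul0r sin0 expR0.
by rewrite le_eqVlt; apply/orP; left; apply/eqP; congr (`| _ |); ring.
Qed.

(** With q = n+1, E(w) = E(w/q)^q, and a difference of q-th powers is the difference of the bases
    times q terms, each at most M = exp |w|. The derivative of E at 0 makes q times the difference
    of the bases at most e/M. *)
Lemma cexp_lim w e : 0 < e -> exists N, forall n, (N <= n)%N ->
  `|(1 + w / n.+1%:R) ^+ n.+1 - cexp w| <= e%:C.
Proof.
move=> e0; pose r := complex.Re `|w|.
have rE : `|w| = r%:C by rewrite RRe_real // normr_real.
pose M := expR r.
have M0 : 0 < M by exact: expR_gt0.
have [|N HN] := @cexp_derive0_seq w (e / M); first by rewrite divr_gt0.
exists N => n /HN; set q := n.+1%:R => A.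
have nE : q = (n.+1%:R : R)%:C :> R[i] by rewrite rmorph_nat.
have q0 : q != 0 by rewrite pnatr_eq0.
have wq : cexp w = cexp (w / q) ^+ n.+1 by rewrite -cexpMn mulrCA divff ?mulr1.
(* [m] bounds both bases, and a product of n of them is at most m^n <= M. *)
pose m := expR (r / n.+1%:R).
have mM : (m ^+ n <= M).
  apply: (@le_trans _ _ (m ^+ n.+1)).
    rewrite exprSr ler_peMr ?exprn_ge0 ?expR_ge0 // -[1]expR0 ler_expR.
    by rewrite divr_ge0 ?ler0n // -ler0c -rE.
  by rewrite /m -expRM_natl mulrCA divff ?mulr1 // pnatr_eq0.
have w_q : `|w / q| = (r / n.+1%:R)%:C.
  by rewrite normrM normfV rE nE normc_def /= expr0n /= addr0 sqrtr_sqr ger0_norm ?ler0n // fmorph_div.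
have a1 : `|1 + w / q| <= m%:C.
  apply: le_trans (ler_normD _ _) _; rewrite normr1 w_q -(rmorph1 (real_complex R)) -rmorphD lecR.
  exact: expR_ge1Dx.
have a2 : `|cexp (w / q)| <= m%:C.
  rewrite norm_cexp lecR ler_expR -lecR -w_q.
  by apply: le_trans (normc_ge_Re _); rewrite lecR ler_norm.
rewrite wq subrXX normrM.
apply: (@le_trans _ _ (`|1 + w / q - cexp (w / q)| * (n.+1%:R * (M%:C)))).
  apply: ler_wpM2l; first exact: normr_ge0.
  apply: le_trans (ler_norm_sum _ _ _) _.
  rewrite mulr_natl -[X in _ *+ X]card_ord -sumr_const; apply: ler_sum => i _.
  rewrite normrM !normrX.
  apply: (@le_trans _ _ (m%:C ^+ (n.+1.-1 - i) * m%:C ^+ i)).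
    by apply: ler_pM; rewrite ?exprn_ge0 ?normr_ge0 //;
      apply: lerXn2r; rewrite ?nnegrE ?normr_ge0 ?ler0c ?expR_ge0.
  by rewrite -exprD subnK -1?ltnS // -rmorphXn lecR.
rewrite mulrA.
have -> : `|1 + w / q - cexp (w / q)| * n.+1%:R = `|q * (cexp (w / q) - 1) - w|.
  rewrite -[X in _ * X](@ger0_norm _ n.+1%:R) ?ler0n // -normrM -normrN; congr (`| _ |).
  by rewrite -/q; field; rewrite nat1r.
have eM : (e / M)%:C * M%:C = e%:C by rewrite -rmorphM /= divfK // gt_eqF.
have MC0 : 0 <= M%:C by rewrite ler0c ltW.
have := ler_wpM2r MC0 A; rewrite eM.
exact.
Qed.

End Exponential.

(** * Hyperbolic polynomials as products of real linear factors *)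

Section Hyperbolic.
Variable R : realType.
Implicit Types (p : {poly R[i]}) (c z : R[i]) (n : nat).

Lemma hyperbolic_factor p : hyperbolic p ->
  exists (c : R) (rs : seq R),
    c != 0 /\ p = c%:C *: \prod_(r <- rs) ('X - (r%:C)%:P).
Proof.
move=> [p0 pR pz]; have [rs ep] := closed_field_poly_normal p.
have lR : lead_coef p \is Num.real by exact: (polyOverP pR).
have [c ec] := complex_realP _ lR.
exists c, [seq complex.Re r | r <- rs]; split.
  by apply: contra_neq p0 => c0; apply/eqP; rewrite -lead_coef_eq0 ec c0.
rewrite {1}ep ec big_map; congr (_ *: _); rewrite !big_seq; apply: eq_bigr => r rrs.
rewrite RRe_real //; apply: pz.
by rewrite ep rootZ ?lead_coef_eq0 // root_prod_XsubC.
Qed.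

Lemma hyperbolicXn n : hyperbolic ('X^n : {poly R[i]}).
Proof.
split; first by rewrite -size_poly_eq0 size_polyXn.
  exact: polyOverXn.
move=> z; rewrite /root hornerXn expf_eq0 => /andP[_ /eqP ->].
exact: real0.
Qed.

Lemma norm_le_Im c z : complex.Re c = complex.Re z ->
  complex.Im c ^+ 2 <= complex.Im z ^+ 2 -> `|c| <= `|z|.
Proof.
by move=> e le; rewrite !normc_def lecR e ler_wsqrtr // lerD2l.
Qed.

(* [c ^+ n * p.[- c^-1]] is, up to sign, the value at [c] of the reversed
   polynomial, a product of real affine factors [1 + r c]. *)
Lemma hyperbolic_reversed_le n p c z : hyperbolic p -> (size p <= n.+1)%N ->
    c != 0 -> z != 0 -> complex.Re c = complex.Re z ->
    complex.Im c ^+ 2 <= complex.Im z ^+ 2 ->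
  `|c ^+ n * p.[- c^-1]| <= `|z ^+ n * p.[- z^-1]|.
Proof.
move=> /hyperbolic_factor [A [rs [A0 ->]]] sp c0 z0 ecz lcz.
have {}sp : (size rs <= n)%N.
  move: sp; rewrite size_scale ?size_prod_XsubC //.
  by rewrite (inj_eq (@complexI _) _ 0).
have E (x : R[i]) : x != 0 -> x ^+ n * (A%:C *: \prod_(r <- rs) ('X - (r%:C)%:P)).[- x^-1]
    = A%:C * (x ^+ (n - size rs) * \prod_(r <- rs) - (1 + r%:C * x)).
  move=> x0; rewrite hornerZ mulrCA; congr (_ * _).
  rewrite -{1}(subnK sp) exprD -mulrA; congr (_ * _).
  rewrite horner_prod.
  have -> : x ^+ size rs = \prod_(r <- rs) x.
    by elim: (rs) => [|r s IH]; rewrite ?big_nil // big_cons -IH exprS.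
  by rewrite -big_split; apply: eq_bigr => r _; rewrite !hornerE /=; field.
rewrite !E // !normrM; apply: ler_wpM2l; first exact: normr_ge0.
apply: ler_pM; rewrite ?normr_ge0 //.
  rewrite !normrX; apply: lerXn2r; rewrite ?nnegrE ?normr_ge0 //.
  exact: norm_le_Im.
rewrite !normr_prod; apply: ler_prod => r _; rewrite normr_ge0 !normrN.
apply: norm_le_Im; case: c z ecz lcz {c0 z0} => [a b] [a' b'] /= -> le.
  by rewrite !mul0r !subr0.
rewrite !mul0r !addr0 !add0r !exprMn; apply: ler_wpM2l le; exact: sqr_ge0.
Qed.

Lemma conjC_imaginary z : complex.Re z = 0 -> z^* = - z.
Proof.
by case: z => x y /= ->; rewrite -[_^*]/(conjc _) /= -[RHS]/(oppc _) /= oppr0.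
Qed.

End Hyperbolic.

(** * The generating function as a limit of images of monomials, and its zeros *)

Section DifferenceOperator.
Variables (R : realType) (l m : int) (h : R[i]) (a : int -> R[i]).
Hypothesis hlm : l < m.
Implicit Types (p : {poly R[i]}) (c z t w : R[i]) (n : nat).

Local Notation T := (difference_op a l m h).
Local Notation d := (absz (m - l)).

Lemma zrangeE : zrange l m = [seq l + i%:Z | i <- iota 0 d.+1].
Proof.
rewrite /zrange; congr map; congr iota; lia.
Qed.

Lemma big_zrange (V : nmodType) (F : int -> V) :
  \sum_(k <- zrange l m) F k = \sum_(i < d.+1) F (l + i%:Z).
Proof. by rewrite zrangeE big_map -{1}[d.+1]subn0 -/(index_iota _ _) big_mkord. Qed.

Lemma uniq_zrange : uniq (zrange l m).
Proof.
by rewrite zrangeE map_inj_uniq ?iota_uniq // => i j /addrI [].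
Qed.

(** Shifting the exponents by [l] turns the Laurent polynomial Q into an ordinary polynomial, to
    which root counting and factorization apply. *)
Definition generating_poly : {poly R[i]} := \poly_(i < d.+1) a (l + i%:Z).

Lemma generating_polyE t : t != 0 ->
  generating_function a l m t = t ^ l * generating_poly.[t].
Proof.
move=> t0; rewrite /generating_function big_zrange horner_poly mulr_sumr.
by apply: eq_bigr => i _; rewrite mulrCA expfzDr.
Qed.

Lemma size_generating_poly : a m != 0 -> size generating_poly = d.+1.
Proof.
move=> am; rewrite /generating_poly size_poly_eq //=.
by rewrite (_ : l + d%:Z = m) //; lia.
Qed.

Lemma size_difference_op p : (size (T p) <= size p)%N.
Proof.
apply: leq_trans (size_sum _ _ _) _; apply/bigmax_leqP_seq => k _ _.
by apply: leq_trans (size_scale_leq _ _) _; rewrite size_comp_poly2 // size_XsubC.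
Qed.

(** At x = -1/c one has c (x - k h) = -(1 + k h c); the sign (-1)^n disappears in the modulus. *)
Lemma difference_op_Xn n c : c != 0 ->
  `|c ^+ n * (T 'X^n).[- c^-1]|
  = `|\sum_(k <- zrange l m) a k * (1 + k%:~R * h * c) ^+ n|.
Proof.
move=> c0; rewrite difference_opE.
transitivity (`|(-1) ^+ n * \sum_(k <- zrange l m) a k * (1 + k%:~R * h * c) ^+ n|).
  rewrite !mulr_sumr; congr (`| _ |); apply: eq_bigr => k _.
  rewrite hornerXn mulrCA -exprMn [RHS]mulrCA -exprMn.
  by congr (_ * _ ^+ _); field.
by rewrite normrM normrX normrN1 expr1n mul1r.
Qed.

Lemma generating_function_lim z (e : R) : 0 < e ->
  exists N, forall n, (N <= n)%N ->
  `|\sum_(k <- zrange l m) a k * (1 + k%:~R * h * (z / n.+1%:R)) ^+ n.+1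
    - generating_function a l m (cexp (h * z))| <= e%:C.
Proof.
rewrite /generating_function; elim: (zrange l m) e => [|k s IH] e e0.
  by exists 0%N => n _; rewrite !big_nil subr0 normr0 ler0c ltW.
have e2 : 0 < e / 2 by rewrite divr_gt0.
have [N1 H1] := IH _ e2.
pose b := complex.Re `|a k|.
have bE : `|a k| = b%:C by rewrite RRe_real // normr_real.
have b0 : 0 <= b by rewrite -ler0c -bE.
have b1 : 0 < b + 1 by rewrite ltr_wpDl.
(* Dividing by b + 1 instead of b covers the case [a k = 0]. *)
have [|N2 H2] := @cexp_lim R (k%:~R * h * z) (e / 2 / (b + 1)); first exact: divr_gt0.
exists (maxn N1 N2) => n; rewrite geq_max => /andP[/H1 A /H2 B].
rewrite !big_cons opprD addrACA [e]splitr rmorphD /=.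
apply: le_trans (ler_normD _ _) _; apply: lerD; last exact: A.
rewrite -mulrBr -cexpMz !mulrA normrM bE.
apply: (@le_trans _ _ (b%:C * (e / 2 / (b + 1))%:C)).
  by apply: ler_wpM2l; rewrite ?ler0c.
rewrite -rmorphM lecR /= mulrCA ler_piMr ?ltW //.
by rewrite ltr_pdivrMr // mul1r ltrDl.
Qed.

Hypothesis T_hyp : preserves_hyperbolic T.

(** If e = |Q(E(h w))| were positive, approximants within e/3 would give |Jw| <= |Jz| <= e/3, hence
    e <= 2e/3. *)
Lemma generating_function_vertical z w : z != 0 -> w != 0 ->
    complex.Re w = complex.Re z -> complex.Im w ^+ 2 <= complex.Im z ^+ 2 ->
    generating_function a l m (cexp (h * z)) = 0 ->
  generating_function a l m (cexp (h * w)) = 0.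
Proof.
move=> z0 w0 ewz lwz Qz; apply/eqP/negP => /negP Qw.
pose e := complex.Re `|generating_function a l m (cexp (h * w))|.
have eE : `|generating_function a l m (cexp (h * w))| = e%:C.
  by rewrite RRe_real // normr_real.
have e0 : 0 < e by rewrite -(@ltcR R 0 e) -eE normr_gt0.
have e3 : 0 < e / 3 by rewrite divr_gt0.
have [N1 H1] := generating_function_lim z e3.
have [N2 H2] := generating_function_lim w e3.
have {H1} A := H1 _ (leq_maxl N1 N2).
have {H2} B := H2 _ (leq_maxr N1 N2).
set n := maxn N1 N2 in A B; rewrite Qz subr0 in A.
set Jz := \sum_(k <- _) _ in A; set Jw := \sum_(k <- _) _ in B.
have nE : n.+1%:R^-1 = (n.+1%:R^-1)%:C :> R[i] by rewrite fmorphV rmorph_nat.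
(* Both sums are, up to sign, values of the reversed image of X^(n+1), at w/(n+1) and z/(n+1), so
   monotonicity in the imaginary part compares them. *)
have JJ : `|Jw| <= `|Jz|.
  have zn0 : z / n.+1%:R != 0 by rewrite mulf_neq0 // invr_eq0 pnatr_eq0.
  have wn0 : w / n.+1%:R != 0 by rewrite mulf_neq0 // invr_eq0 pnatr_eq0.
  rewrite -!difference_op_Xn //.
  have [HT|->] := T_hyp (hyperbolicXn R n.+1); last by rewrite !horner0 !mulr0.
  apply: hyperbolic_reversed_le HT _ wn0 zn0 _ _.
  - by apply: leq_trans (size_difference_op _) _; rewrite size_polyXn.
  - by rewrite nE; case: (z) (w) ewz => [? ?] [? ?] /= ->; rewrite !mulr0 !subr0.
  - rewrite nE; case: (z) (w) lwz => [? ?] [? ?] /= le.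
    by rewrite !mulr0 !add0r !exprMn; apply: ler_wpM2r le; exact: sqr_ge0.
have : e%:C <= (e / 3)%:C + (e / 3)%:C.
  rewrite -eE -[generating_function _ _ _ _](subKr Jw).
  apply: le_trans (ler_normB _ _) _; apply: lerD; last exact: B.
  exact: le_trans JJ A.
by rewrite -rmorphD lecR /=; lra.
Qed.

Hypotheses (h0 : h != 0) (am0 : a m != 0).

(** A zero x + i y with y nonzero would spread to the points x + i v_j below it, whose images u_j =
    E(h (x + i v_j)) are d + 1 distinct roots of a polynomial of degree d. *)
Lemma generating_function_root_real z :
  generating_function a l m (cexp (h * z)) = 0 -> complex.Im z = 0.
Proof.
move=> Qz; apply/eqP/negP => /negP; case: z Qz => x y /= Qz y0.
have Q0 : generating_poly != 0.
  by rewrite -size_poly_gt0 size_generating_poly.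
case eh: h h0 Qz => [al be] hh0 Qz.
(* The first bound keeps the points on the segment where zeros propagate; the second keeps |al| v_j
   in [0, pi], where cosine is injective. The added 1 avoids dividing by zero. *)
pose de := Num.min `|y| (pi / (`|al| + 1)).
have al1 : 0 < `|al| + 1 by rewrite ltr_wpDl.
have de0 : 0 < de by rewrite lt_min normr_gt0 y0 divr_gt0 ?pi_gt0.
have dey : de <= `|y| by rewrite ge_min lexx.
have deal : `|al| * de <= pi.
  apply: (@le_trans _ _ ((`|al| + 1) * de)).
    by apply: ler_wpM2r; rewrite ?ltW // ltrDl.
  by rewrite mulrC -ler_pdivlMr // ge_min lexx orbT.
pose v (j : nat) : R := de / j.+1%:R.
have v0 j : 0 < v j by rewrite divr_gt0 // ltr0n.
have vde j : v j <= de.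
  by rewrite ler_pdivrMr ?ltr0n // ler_peMr ?(ltW de0) // ler1n.
have vI : injective v.
  move=> i j /(mulfI (lt0r_neq0 de0)) /invr_inj /eqP.
  by rewrite eqr_nat => /eqP [].
pose u j := cexp (Complex al be * Complex x (v j)).
(* The modulus of u_j is exp (al x - be v_j), which determines v_j unless be = 0; in that case the
   real part exp (al x) cos (al v_j) does. *)
have uI : injective u.
  move=> i j uij; have /(congr1 Num.norm) := uij.
  rewrite !norm_cexp => /complexI /expR_inj /= /addrI /oppr_inj E.
  have [be0|be0] := eqVneq be 0; last by move: E => /(mulfI be0) /vI.
  have al0 : al != 0.
    by move: hh0; rewrite be0 eq_complex /= eqxx andbT.
  move: uij => /(congr1 (@complex.Re R)) /=; rewrite be0 !mul0r !addr0 !subr0.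
  have /lt0r_neq0 ex0 := expR_gt0 (al * x); move=> /(mulfI ex0).
  rewrite -[cos (al * v i)]cos_norm -[cos (al * v j)]cos_norm.
  move=> /cos_inj; rewrite !in_itv /= !normr_ge0 /= !(normrM al).
  rewrite !(gtr0_norm (v0 _)).
  have b k : `|al| * v k <= pi.
    by apply: le_trans deal; apply: ler_wpM2l.
  by rewrite !b => /(_ isT isT) /mulfI; rewrite normr_eq0 => /(_ al0) /vI.
have := @max_poly_roots _ generating_poly [seq u j | j <- iota 0 d.+1] Q0.
rewrite size_map size_iota size_generating_poly // ltnn => H.
suff: false by []; apply: H; last by rewrite map_inj_uniq // iota_uniq.
apply/allP => _ /mapP [j _ ->]; rewrite /root.
have xy0 : Complex x y != 0 by rewrite eq_complex /= negb_and y0 orbT.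
have xv0 : Complex x (v j) != 0 by rewrite eq_complex /= negb_and (gt_eqF (v0 j)) orbT.
have vy : v j ^+ 2 <= y ^+ 2.
  rewrite -(real_normK (num_real y)); apply: lerXn2r; rewrite ?nnegrE ?normr_ge0 ?(ltW (v0 j)) //.
  exact: le_trans (vde j) dey.
rewrite -eh in Qz; rewrite /u -eh.
have := generating_function_vertical xy0 xv0 erefl vy Qz.
rewrite generating_polyE ?cexp_neq0 // => /eqP; rewrite mulf_eq0 => /orP[|//].
by rewrite expfz_eq0 (negbTE (cexp_neq0 _)) andbF.
Qed.

End DifferenceOperator.

(** * Necessity of the four conditions *)

Section Necessity.
Variables (R : realType) (l m : int) (h : R[i]) (a : int -> R[i]).
Hypotheses (hlm : l < m) (h0 : h != 0) (al0 : a l != 0) (am0 : a m != 0).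
Hypothesis T_hyp : preserves_hyperbolic (difference_op a l m h).

Local Notation Q := (generating_function a l m).

Lemma generating_function_root_imaginary t : t != 0 -> Q t = 0 ->
  exists r : R, t = cexp (h * r%:C).
Proof.
move=> /cexp_surj [w <-] Qw; exists (complex.Re (w / h)).
have : complex.Im (w / h) = 0.
  apply: (generating_function_root_real hlm T_hyp h0 am0).
  by rewrite mulrC divfK.
move: (divfK h0 w); case: (w / h) => x y /= + y0; rewrite y0 => {1}<-.
by rewrite mulrC.
Qed.

(** The degree m - l is positive, and the constant coefficient [a l] is nonzero, so a root exists
    and is not 0. *)
Lemma exists_generating_function_root : exists2 t, t != 0 & Q t = 0.
Proof.
have sQ : size (generating_poly l m a) != 1%N.
  by rewrite size_generating_poly //; lia.
have [t rt] := closed_rootP _ sQ.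
have t0 : t != 0.
  apply: contraTneq rt => ->; rewrite /root horner_coef0 coef_poly /= addr0.
  exact: al0.
exists t => //; rewrite generating_polyE //.
by move/eqP: rt => ->; rewrite mulr0.
Qed.

(** The logarithms w and w + 2 pi i of one root both become real after division by h, so 2 pi i / h
    is real. *)
Lemma preserves_hyperbolic_Re : complex.Re h = 0.
Proof.
have [t t0 Qt] := exists_generating_function_root.
have [w wt] := cexp_surj t0.
have real_div (w' : R[i]) : cexp w' = t -> complex.Im (w' / h) = 0.
  move=> w't; apply: (generating_function_root_real hlm T_hyp h0 am0).
  by rewrite mulrC divfK // w't.
have I1 := real_div _ wt.
have I2 : complex.Im ((w + Complex 0 (pi *+ 2)) / h) = 0.
  by apply: real_div; rewrite cexp_period.
pose q : R[i] := Complex 0 (pi *+ 2) / h.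
have Iq : complex.Im q = 0.
  by move: I2; rewrite mulrDl raddfD /= I1 add0r.
have := divfK h0 (Complex 0 (pi *+ 2)); rewrite -/q.
case: (q) Iq => r i /= ->; case: (h) => x y /=.
rewrite /GRing.mul /= => -[]; rewrite !mul0r subr0 addr0 => rx ry.
have r0 : r != 0.
  apply: contra_eq_neq ry => ->; rewrite mul0r eq_sym.
  by rewrite mulrn_eq0 (gt_eqF (pi_gt0 R)).
by apply/eqP; move/eqP: rx; rewrite mulf_eq0 (negbTE r0).
Qed.

Lemma preserves_hyperbolic_root t : t != 0 -> Q t = 0 -> `|t| = 1.
Proof.
move=> t0 /(generating_function_root_imaginary t0) [r ->].
rewrite norm_cexp; have := preserves_hyperbolic_Re; case: (h) => x y /= ->.
by rewrite mul0r mulr0 subr0 expR0.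
Qed.

Lemma conjC_h : h^* = - h.
Proof. exact: conjC_imaginary preserves_hyperbolic_Re. Qed.

(** For f = X^n the left side is T(X^n)(0), a real number; conjugating it and using that h is
    imaginary gives the right side. Linearity extends this to all f. *)
Lemma difference_op_moment_conj (f : {poly R[i]}) :
  \sum_(k <- zrange l m) a k * f.[- (k%:~R * h)] =
  \sum_(k <- zrange l m) (a k)^* * f.[k%:~R * h].
Proof.
have moment n : \sum_(k <- zrange l m) a k * (- (k%:~R * h)) ^+ n =
    \sum_(k <- zrange l m) (a k)^* * (k%:~R * h) ^+ n.
  have /CrealP : \sum_(k <- zrange l m) a k * (- (k%:~R * h)) ^+ n \is Num.real.
    have -> : \sum_(k <- zrange l m) a k * (- (k%:~R * h)) ^+ n =
        (difference_op a l m h 'X^n).[0].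
      by rewrite difference_opE; apply: eq_bigr => k _; rewrite hornerXn sub0r.
    have [[_ TR _]|->] := T_hyp (hyperbolicXn R n); last by rewrite horner0 real0.
    by rewrite horner_coef0; apply: (polyOverP TR).
  move=> <-; rewrite rmorph_sum; apply: eq_bigr => k _.
  by rewrite rmorphM rmorphXn rmorphN rmorphM /= conjC_h rmorph_int mulrN opprK.
transitivity (\sum_(i < size f) f`_i * \sum_(k <- zrange l m) a k * (- (k%:~R * h)) ^+ i).
  under [RHS]eq_bigr do rewrite mulr_sumr.
  rewrite exchange_big; apply: eq_bigr => k _; rewrite horner_coef mulr_sumr.
  by apply: eq_bigr => i _; rewrite mulrCA.
under eq_bigr do rewrite moment mulr_sumr.
rewrite exchange_big; apply: eq_bigr => k _; rewrite horner_coef mulr_sumr.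
by apply: eq_bigr => i _; rewrite mulrCA.
Qed.

Lemma coefficients_conj (j : int) : l <= j <= m -> a j != 0 ->
  (l <= - j <= m) /\ a j = (a (- j))^*.
Proof.
rewrite -!mem_zrange => jr aj0.
(* The node set is closed under negation, so [f] vanishes at the nodes of both sums except the one
   at -j h: the left sum reduces to the index j, the right one to -j, or to nothing when -j is out
   of range. *)
pose pts := zrange l m ++ [seq - k | k <- zrange l m].
pose f : {poly R[i]} := \prod_(i <- pts | i != j) ('X - (- (i%:~R * h))%:P).
have f0 k : k \in pts -> k != j -> f.[- (k%:~R * h)] = 0.
  move=> kp kj; rewrite horner_prod; apply/eqP; rewrite prodf_seq_eq0.
  by apply/hasP; exists k => //; rewrite kj !hornerE subrr eqxx.
have fj : f.[- (j%:~R * h)] != 0.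
  rewrite horner_prod prodf_seq_neq0; apply/allP => i _; apply/implyP => ij.
  rewrite !hornerE opprK addrC -mulrBl mulf_neq0 // -rmorphB intr_eq0 subr_eq0.
  exact: ij.
have := difference_op_moment_conj f.
rewrite (bigD1_seq j) ?uniq_zrange //= big_seq_cond big1 ?addr0; last first.
  by move=> k /andP[kr kj]; rewrite f0 ?mulr0 // mem_cat kr.
have fN k : k \in zrange l m -> k != - j -> f.[k%:~R * h] = 0.
  move=> kr kj; rewrite -[k]opprK mulrNz mulNr f0 //.
    by rewrite mem_cat orbC map_f.
  by rewrite eqr_oppLR.
have [Njr|Njr] := boolP (- j \in zrange l m); last first.
  rewrite big_seq big1 => [/eqP|k kr].
    by rewrite mulf_eq0 (negbTE aj0) (negbTE fj).
  by rewrite fN ?mulr0 //; apply: contraNneq Njr => <-.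
rewrite (bigD1_seq (- j)) ?uniq_zrange //= big_seq_cond big1 ?addr0; last first.
  by move=> k /andP[kr kj]; rewrite fN ?mulr0.
by rewrite mulrNz mulNr => /(mulIf fj).
Qed.

Lemma preserves_hyperbolic_bounds : l = - m.
Proof.
have [|/andP[A1 A2] _] := @coefficients_conj l _ al0; first by rewrite lexx ltW.
have [|/andP[B1 B2] _] := @coefficients_conj m _ am0; first by rewrite lexx ltW.
lia.
Qed.

Lemma preserves_hyperbolic_extreme : 0 < a m * a (- m).
Proof.
have [|_ E] := @coefficients_conj m _ am0; first by rewrite lexx ltW.
by rewrite {1}E mulrC mul_conjC_gt0 -preserves_hyperbolic_bounds.
Qed.

End Necessity.

(** * Sufficiency: factorization into two-term operators *)

Section Sufficiency.
Variable R : realType.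
Implicit Types (p q : {poly R[i]}) (s x z : R[i]).

Lemma hyperbolic_or0_scale p (c : R[i]) : c \is Num.real ->
  hyperbolic p \/ p = 0 -> hyperbolic (c *: p) \/ c *: p = 0.
Proof.
move=> cR [[p0 pR pz]|->]; last by right; rewrite scaler0.
have [->|c0] := eqVneq c 0; first by right; rewrite scale0r.
left; split; first by rewrite scaler_eq0 negb_or c0.
  by apply/polyOverP => i; rewrite coefZ rpredM // (polyOverP pR).
by move=> z; rewrite rootZ //; exact: pz.
Qed.

(** For g imaginary and |s| = 1, conjugation exchanges the two terms; the factor i absorbs the
    resulting sign, so real coefficients stay real. *)
Definition half_shift_op (g s : R[i]) p : {poly R[i]} :=
  'i *: (s^-1 *: (p \Po ('X - g%:P)) - s *: (p \Po ('X + g%:P))).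

Lemma half_shift_opE g s p x :
  (half_shift_op g s p).[x] = 'i * (s^-1 * p.[x - g] - s * p.[x + g]).
Proof. by rewrite /half_shift_op !(hornerE, horner_comp). Qed.

Lemma half_shift_op_real g s p : g^* = - g -> `|s| = 1 ->
  p \is a polyOver Num.real -> half_shift_op g s p \is a polyOver Num.real.
Proof.
move=> gJ s1 pR.
have sJ : s^* = s^-1 by rewrite invC_norm s1 expr1n invr1 mul1r.
have pJ : map_poly Num.conj p = p.
  by apply/polyP => i; rewrite coef_map /= conj_Creal ?(polyOverP pR).
apply/polyOverP => i; apply/CrealP; rewrite -coef_map /=; congr (_`_i).
rewrite /half_shift_op linearZ /= rmorphB /= !linearZ /= !map_comp_poly pJ.
rewrite rmorphB rmorphD /= map_polyX map_polyC /= gJ polyCN opprK.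
rewrite conjCi -[(_^-1)^*]/(Num.conj _) fmorphV /= sJ invrK.
by rewrite scaleNr -scalerN opprD !scalerN opprK addrC.
Qed.

(** At a root z the values p(z - g) and p(z + g) have equal modulus. If z is not real, the two
    points share their real part but differ in |Im|, so every factor of p is strictly larger at one
    of them. *)
Lemma half_shift_op_hyperbolic g s p : g != 0 -> g^* = - g -> `|s| = 1 ->
  hyperbolic p \/ p = 0 ->
  hyperbolic (half_shift_op g s p) \/ half_shift_op g s p = 0.
Proof.
move=> g0 gJ s1 [hp|->]; last by right; rewrite /half_shift_op !comp_poly0 !scaler0 subr0 scaler0.
have [->|U0] := eqVneq (half_shift_op g s p) 0; [by right|left].
have [_ pR _] := hp; split=> //; first exact: half_shift_op_real.
move=> z /eqP rz.
have [c [rs [c0 ep]]] := hyperbolic_factor hp.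
have s0 : s != 0 by rewrite -normr_eq0 s1 oner_eq0.
have En : `|p.[z - g]| = `|p.[z + g]|.
  move: rz; rewrite half_shift_opE => /eqP; rewrite mulf_eq0 (negbTE (neq0Ci _)) /= subr_eq0.
  by move=> /eqP /(congr1 Num.norm); rewrite !normrM normfV s1 invr1 !mul1r.
(* With no factor the inequality is not strict; but then the image is a constant with a root, hence
   zero, which was excluded. *)
have [rs0|rs0] := eqVneq rs [::].
  have pc : p = (c%:C)%:P by rewrite ep rs0 big_nil alg_polyC.
  have Uc : half_shift_op g s p = ('i * (s^-1 * c%:C - s * c%:C))%:P.
    by rewrite /half_shift_op pc !comp_polyC -!mul_polyC -!polyCM -polyCB -polyCM.
  by move: rz U0; rewrite Uc hornerC => ->; rewrite eqxx.
have cC0 : 0 < `|c%:C| by rewrite normr_gt0 (inj_eq (@complexI _) _ 0).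
have hrs : has predT rs by case: (rs) rs0.
have prodlt (u v : R[i]) : complex.Re u = complex.Re v ->
    complex.Im u ^+ 2 < complex.Im v ^+ 2 -> `|p.[u]| < `|p.[v]|.
  move=> eR lI; rewrite ep !hornerZ !normrM ltr_pM2l // !horner_prod !normr_prod.
  apply: ltr_prod => // r _; rewrite normr_ge0 /= !hornerE !normc_def ltcR.
  case: u v eR lI => [u1 u2] [v1 v2] /= -> lI.
  by rewrite ltr_sqrt ?oppr0 ?addr0 ?ltrD2l // ltr_wpDl ?sqr_ge0 // (le_lt_trans _ lI) ?sqr_ge0.
move: gJ g0 En; case: g {rz U0} => g1 g2; case: z => x y.
rewrite -/(conjc (Complex g1 g2)) => gJ g0 En.
have g10 : g1 = 0 by have /(congr1 (@complex.Re R)) /= := gJ; lra.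
have g20 : g2 != 0 by move: g0; rewrite g10 eq_complex /= eqxx.
rewrite complex_real; apply/negP => /negP y0.
(* The sign of (y + g2)^2 - (y - g2)^2 = 4 y g2 tells which point is farther from the real axis. *)
have : 0 < y * g2 \/ y * g2 < 0.
  by case: (ltrgt0P (y * g2)) => [|| /eqP]; [left|right|rewrite mulf_eq0 (negbTE y0) (negbTE g20)].
case=> yg.
  suff : `|p.[Complex x y - Complex g1 g2]| < `|p.[Complex x y + Complex g1 g2]|.
    by rewrite En ltxx.
  by apply: prodlt => /=; [rewrite g10 oppr0 | nra].
suff : `|p.[Complex x y + Complex g1 g2]| < `|p.[Complex x y - Complex g1 g2]|.
  by rewrite En ltxx.
by apply: prodlt => /=; [rewrite g10 oppr0 | nra].
Qed.

(** Once s^-1 is cleared, each operator multiplies the generating polynomial by X - s^2: the term X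
    goes with p(x - g), the term -s^2 with p(x + g). *)
Lemma iter_half_shift_opE g (ss : seq R[i]) p x : all (predC1 0) ss ->
  (\prod_(s <- ss) s) * (foldr (half_shift_op g) p ss).[x] =
  'i ^+ size ss * \sum_(i < (size ss).+1)
    (\prod_(s <- ss) ('X - (s ^+ 2)%:P))`_i * p.[x - (i%:R *+ 2 - (size ss)%:R) * g].
Proof.
elim: ss x => [|s ss IH] x /=.
  by move=> _; rewrite !big_nil big_ord_recl big_ord0 coef1 addr0 !mul1r mul0rn subr0 mul0r subr0.
move=> /andP[s0 ss0]; rewrite !big_cons half_shift_opE.
set P := \prod_(_ <- _) ('X - _); set n := size ss.
have sP : size P = n.+1
  by rewrite /P -(big_map (fun s => s ^+ 2) predT (fun t => 'X - t%:P)) size_prod_XsubC size_map.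
set q := foldr _ _ _; set b := \prod_(_ <- _) _.
have -> : s * b * ('i * (s^-1 * q.[x - g] - s * q.[x + g])) =
    'i * (b * q.[x - g] - s ^+ 2 * (b * q.[x + g])) by field.
rewrite !IH // mulrCA -mulrBr mulrA -exprS; congr (_ * _).
rewrite mulrBl.
under [RHS]eq_bigr do rewrite coefB mulrBl.
rewrite sumrB; congr (_ - _).
  (* The X part has no constant coefficient, so its indices move up by one; in the other part the
     coefficient of P at n + 1 lies beyond its degree and is 0. *)
  rewrite [RHS]big_ord_recl coefXM eqxx mul0r add0r; apply: eq_bigr => i _.
  rewrite coefXM /= /bump /= add1n; congr (_ * p.[_]).
  by rewrite -!natr1; ring.
rewrite [RHS]big_ord_recr /= coefCM [P`_n.+1]nth_default ?sP // mulr0 mul0r addr0.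
rewrite mulr_sumr; apply: eq_bigr => i _; rewrite coefCM mulrA; congr (_ * p.[_]).
by rewrite -!natr1; ring.
Qed.

Lemma eq_horner_poly p q : (forall x, p.[x] = q.[x]) -> p = q.
Proof.
move=> pq; apply/eqP; rewrite -subr_eq0; apply/eqP.
pose rs : seq R[i] := [seq i%:R | i <- iota 0 (size (p - q))].
apply: (@roots_geq_poly_eq0 _ _ rs).
- by apply/allP => x _; rewrite /root hornerD hornerN pq subrr.
- by rewrite map_inj_uniq ?iota_uniq // => i j /eqP; rewrite eqr_nat => /eqP.
- by rewrite size_map size_iota.
Qed.

Lemma difference_op_preserves (m : int) (h : R[i]) (a : int -> R[i]) :
    - m < m -> h != 0 -> complex.Re h = 0 -> a m != 0 ->
    (forall t, t != 0 -> generating_function a (- m) m t = 0 -> `|t| = 1) ->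
    0 < a m * a (- m) ->
  preserves_hyperbolic (difference_op a (- m) m h).
Proof.
move=> hm h0 Rh am0 Qroot aa p hp.
pose M := absz m; have mM : m = M%:Z by rewrite /M; lia.
have dM : absz (m - - m) = M.*2 by rewrite /M; lia.
(* With 2M operators the shifts (2 i - 2 M) g become (i - M) h, those of T. *)
pose g := h / 2.
have hg : h = g *+ 2 by rewrite -mulr_natr divfK // pnatr_eq0.
have g0 : g != 0 by rewrite mulf_neq0 // invr_eq0 pnatr_eq0.
have hJ := conjC_imaginary Rh.
have gJ : g^* = - g by rewrite /g rmorphM /= hJ fmorphV /= rmorph_nat mulNr.
have sQ := size_generating_poly hm am0; rewrite dM in sQ.
have [ts Pts] := closed_field_poly_normal (generating_poly (- m) m a).
have lQ : lead_coef (generating_poly (- m) m a) = a m.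
  rewrite lead_coefE sQ /= coef_poly dM ltnSn; congr a; lia.
rewrite lQ in Pts.
have sts : size ts = M.*2.
  by move: sQ; rewrite Pts size_scale // size_prod_XsubC => -[].
have Q0 : (generating_poly (- m) m a).[0] = a (- m).
  by rewrite horner_coef0 coef_poly /= addr0.
(* Vieta; the sign is absent because the degree 2M is even. *)
have aNm : a (- m) = a m * \prod_(t <- ts) t.
  rewrite -Q0 Pts hornerZ horner_prod; congr (_ * _).
  transitivity (\prod_(t <- ts) (-1) * \prod_(t <- ts) t).
    by rewrite -big_split; apply: eq_bigr => t _; rewrite hornerXsubC sub0r /= mulN1r.
  rewrite big_const_seq count_predT sts iter_mulr_1.
  by rewrite -mul2n exprM sqrrN !expr1n mul1r.
have aNm0 : a (- m) != 0.
  by apply: contraTneq aa => ->; rewrite mulr0 ltxx.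
have ts1 t : t \in ts -> t != 0 /\ `|t| = 1.
  move=> tts; have rt : (generating_poly (- m) m a).[t] = 0.
    by apply/eqP; rewrite -/(root _ t) Pts rootZ // root_prod_XsubC.
  have t0 : t != 0 by apply: contraNneq aNm0 => t0; move: rt; rewrite t0 Q0 => ->.
  split=> //; apply: Qroot => //.
  by rewrite generating_polyE // rt mulr0.
pose ss := [seq sqrtC t | t <- ts].
have ss1 s : s \in ss -> `|s| = 1.
  move=> /mapP [t /ts1 [_ t1] ->]; apply/eqP.
  by rewrite -(@pexpr_eq1 _ _ 2) ?normr_ge0 // -normrX sqrtCK t1.
have ss0 : all (predC1 0) ss.
  by apply/allP => s /ss1 s1 /=; rewrite -normr_eq0 s1 oner_eq0.
have sss : size ss = M.*2 by rewrite size_map sts.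
(* This is the scalar left over after clearing the inverses. Its square is a_m a_(-m) > 0, so it is
   real: the fourth condition enters here. *)
pose k := a m * \prod_(s <- ss) s.
have k2 : k ^+ 2 = a m * a (- m).
  rewrite /k aNm exprMn expr2 -mulrA; congr (_ * (_ * _)).
  rewrite -prodrXl big_map; apply: eq_bigr => t _; exact: sqrtCK.
have kR : k \is Num.real by rewrite realEsqr k2 ltW.
have iR : ('i : R[i]) ^+ M.*2 = (-1) ^+ M by rewrite -mul2n exprM sqrCi.
have -> : difference_op a (- m) m h p =
    (k * (-1) ^+ M) *: foldr (half_shift_op g) p ss.
  apply: eq_horner_poly => x; rewrite hornerZ -mulrA mulrCA /k -[a m * _ * _]mulrA.
  rewrite iter_half_shift_opE // sss iR (mulrCA (a m)) (mulrA ((-1) ^+ M)) -expr2 sqrr_sign mul1r.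
  rewrite difference_opE big_zrange // dM.
  rewrite mulr_sumr.
  apply: eq_bigr => i _.
  have -> : a (- m + i%:Z) = (generating_poly (- m) m a)`_i.
    by rewrite coef_poly dM ltn_ord.
  rewrite Pts coefZ big_map mulrA; congr (_ * _`_i * p.[_]).
    by congr polyseq; apply: eq_bigr => t _; rewrite sqrtCK.
  have -> : M.*2%:R = 2 * M%:R :> R[i] by rewrite -mul2n natrM.
  rewrite hg mM intrD rmorphN /= -!pmulrn; ring.
apply: hyperbolic_or0_scale; first by rewrite rpredM // rpredX // rpredN rpred1.
elim: ss ss1 {ss0 sss k k2 kR} => [|s ss IH] ss1; first by left.
apply: half_shift_op_hyperbolic => //; first by apply: ss1; rewrite mem_head.
by apply: IH => t tss; apply: ss1; rewrite inE tss orbT.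
Qed.

End Sufficiency.

(* In R[i], 0 < z means that z is a positive real number. *)
Theorem corollary1p4 (R : realType) (l m : int) (h : R[i]) (a : int -> R[i])
    (hlm : l < m) (hh : h != 0) (ha : a l * a m != 0) :
  preserves_hyperbolic (difference_op a l m h) <->
  [/\ complex.Re h = 0,
      l = - m,
      (forall t : R[i], t != 0 -> generating_function a l m t = 0 -> `|t| = 1) &
      0 < a m * a (- m)].
Proof.
move: (ha); rewrite mulf_eq0 negb_or => /andP[al0 am0]; split=> [T_hyp|].
  split.
  - exact: preserves_hyperbolic_Re T_hyp.
  - exact: preserves_hyperbolic_bounds T_hyp.
  - by move=> t; exact: (preserves_hyperbolic_root hlm hh al0 am0 T_hyp).
  - exact: preserves_hyperbolic_extreme T_hyp.
move=> [Rh lm]; move: hlm; rewrite {}lm => hm Qroot aa.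
exact: difference_op_preserves.
Qed.
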